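(* Let $N>1$, let $X_1,\dots,X_N$ be real Banach spaces, $X = X_1\times\cdots\times X_N$, and let $G=(\mathbf{X},\mathcal{J})$ be a generalized Nash game with admissible sets $X_i^{\mathrm{ad}}\subset X_i$, constraint maps $\mathbf{X}_i : X_{-i}\to 2^{X_i}$ and objectives $\mathcal{J}_i : X\to\mathbb{R}$ ($i=1,\dots,N$), such that for every $i$: (a) $X_i^{\mathrm{ad}}$ is nonempty, compact and convex; (b) $\mathbf{X}_i$ is convex-valued and has closed graph, and $\mathbf{X}_i(x_{-i})\subset X_i^{\mathrm{ad}}$ for all $x_{-i}\in X_{-i}^{\mathrm{ad}}$; (c) $\mathcal{J}_i$ is continuous on $X$, and $\mathcal{J}_i(\cdot,x_{-i}):X_i\to\mathbb{R}$ is convex for every $x_{-i}\in X_{-i}$. Assume that the map $\mathbf{X}=\mathbf{X}_1\times\cdots\times\mathbf{X}_N : X^{\mathrm{ad}}\to 2^{X^{\mathrm{ad}}}$ is a KKM map. Then the game $G$ has a generalized Nash equilibrium.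
   Context: Notation: $I=\{1,\dots,N\}$. For $x\in X$ and $i\in I$, $x_{-i}$ denotes the bundle of all components of $x$ except the $i$-th, and $x=(x_i,x_{-i})$ (without changing the order of components). $X_{-i}=\prod_{j\ne i}X_j$, $X_{-i}^{\mathrm{ad}}=\prod_{j\neq i}X_j^{\mathrm{ad}}$, $X^{\mathrm{ad}}=\prod_{j}X_j^{\mathrm{ad}}$. The bundle constraint map is $\mathbf{X}(x)=\mathbf{X}_1(x_{-1})\times\cdots\times\mathbf{X}_N(x_{-N})$. The graph of a set-valued map $F:X\to 2^Y$ is $\{(x,y)\in X\times Y : y\in F(x)\}$. KKM (Knaster–Kuratowski–Mazurkiewicz) map: for a nonempty subset $S$ of a topological vector space $L$, a set-valued map $F:S\to 2^L$ is a KKM map if for each finite subset $\{x_1,\dots,x_n\}$ of $S$ one has $\mathrm{co}(\{x_1,\dots,x_n\})\subset\bigcup_{k=1}^n F(x_k)$, where $\mathrm{co}$ denotes the convex hull. In the game $G=(\mathbf{X},\mathcal{J})$, player $i$, given $x_{-i}\in X_{-i}^{\mathrm{ad}}$, minimizes $\mathcal{J}_i(x_i,x_{-i})$ over $x_i\in X_i^{\mathrm{ad}}\cap\mathbf{X}_i(x_{-i})$. A generalized Nash equilibrium (or simply equilibrium) of $G$ is a point $\overline{x}\in X^{\mathrm{ad}}$ with $\overline{x}\in\mathbf{X}(\overline{x})$ such that for every $i\in I$, $\mathcal{J}_i(\overline{x})=\min\{\mathcal{J}_i(x_i,\overline{x}_{-i}) : x_i\in X_i^{\mathrm{ad}}\cap\mathbf{X}_i(\overline{x}_{-i})\}$.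 *)

(* Defs.v *)
From HB Require Import structures.
From mathcomp Require Import all_boot all_order all_algebra.
From mathcomp Require Import all_classical all_reals all_analysis.
Set Implicit Arguments.
Unset Strict Implicit.
Unset Printing Implicit Defensive.
Import Order.TTheory GRing.Theory Num.Theory.
Import numFieldNormedType.Exports.
Local Open Scope classical_set_scope.
Local Open Scope ring_scope.

(* The library provides [prod_topology T], the dependent product
   [forall i, T i] with its product topology, but gives it no algebraic
   structure.  It is made here a topological vector space with the
   componentwise operations. *)

#[local] Set Warnings "-redundant-canonical-projection".

Section prod_zmodule.
Context {I : Type} (V : I -> zmodType).
Local Notation P := (prod_topology V).

Let add (x y : P) : P := fun i => x i + y i.
Let opp (x : P) : P := fun i => - x i.
Let zero : P := fun i => 0.

Let addA : associative add.
Proof. by move=> x y z; apply: functional_extensionality_dep => i; exact: addrA. Qed.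

Let addC : commutative add.
Proof. by move=> x y; apply: functional_extensionality_dep => i; exact: addrC. Qed.

Let add0 : left_id zero add.
Proof. by move=> x; apply: functional_extensionality_dep => i; exact: add0r. Qed.

Let addN : left_inverse zero opp add.
Proof. by move=> x; apply: functional_extensionality_dep => i; exact: addNr. Qed.

HB.instance Definition _ := GRing.isZmodule.Build P addA addC add0 addN.

End prod_zmodule.

Section prod_lmodule.
Context {R : pzRingType} {I : Type} (V : I -> lmodType R).
Local Notation P := (prod_topology V).

Let scale (a : R) (x : P) : P := fun i => a *: x i.

Let scaleA a b x : scale a (scale b x) = scale (a * b) x.
Proof. by apply: functional_extensionality_dep => i; exact: scalerA. Qed.

Let scale1 : left_id 1 scale.
Proof. by move=> x; apply: functional_extensionality_dep => i; exact: scale1r. Qed.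

Let scaleDr : right_distributive scale +%R.
Proof. by move=> a x y; apply: functional_extensionality_dep => i; exact: scalerDr. Qed.

Let scaleDl x : {morph scale^~ x : a b / a + b}.
Proof. by move=> a b; apply: functional_extensionality_dep => i; exact: scalerDl. Qed.

HB.instance Definition _ :=
  GRing.Zmodule_isLmodule.Build R P scaleA scale1 scaleDr scaleDl.

End prod_lmodule.

Section prod_topological_lmodule.
Context {R : numFieldType} {I : eqType} (V : I -> topologicalLmodType R).
Local Notation P := (prod_topology V).

HB.instance Definition _ := GRing.Lmodule.on P.

Lemma prod_topology_continuous (T : topologicalType) (f : T -> P) :
  (forall i, continuous (fun t => f t i)) -> continuous f.
Proof.
move=> cf t; apply/cvg_sup => i U [W [[A oA <-] fA] WU].
apply: filterS WU _ => /=.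
exact: (cf i t _ (open_nbhs_nbhs (conj oA fA))).
Qed.

Let proj_cont i : continuous (fun x : P => x i).
Proof. exact: (@proj_continuous I V i). Qed.

Let add_cont : continuous (fun z : P * P => z.1 + z.2).
Proof.
apply: prod_topology_continuous => i z.
apply: (@continuous_comp _ (V i * V i)%type _ (fun z : P * P => (z.1 i, z.2 i))
  (fun w => w.1 + w.2)); last exact: add_continuous.
apply: cvg_pair => /=.
  by apply: (@continuous_comp _ P _ fst (fun x : P => x i));
    [exact: cvg_fst|exact: proj_cont].
by apply: (@continuous_comp _ P _ snd (fun x : P => x i));
  [exact: cvg_snd|exact: proj_cont].
Qed.

Let scale_cont : continuous (fun z : R^o * P => z.1 *: z.2).
Proof.
apply: prod_topology_continuous => i z.
apply: (@continuous_comp _ (R^o * V i)%type _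
  (fun z : R^o * P => (z.1, z.2 i)) (fun w => w.1 *: w.2));
  last exact: scale_continuous.
apply: (@cvg_pair _ _ _ _ (nbhs z.1) (nbhs (z.2 i))); first exact: cvg_fst.
by apply: (@continuous_comp _ P _ snd (fun x : P => x i));
  [exact: cvg_snd|exact: proj_cont].
Qed.

HB.instance Definition _ :=
  PreTopologicalNmodule_isTopologicalNmodule.Build P add_cont.
HB.instance Definition _ :=
  TopologicalNmodule_isTopologicalLmodule.Build R P scale_cont.

End prod_topological_lmodule.

Definition convex_hull {R : numDomainType} {L : lmodType R} (A : set L) : set L :=
  smallest (@convex_set R L) A.

(* A set-valued map S -> 2^L is represented by a total function of which only
   the values on S matter.  The finite set {x_1, ..., x_n} is [B]. *)
Definition KKM_map {R : numDomainType} {L : topologicalLmodType R}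
    (S : set L) (F : L -> set L) : Prop :=
  S !=set0 /\
  forall B : set L, finite_set B -> B `<=` S ->
    convex_hull B `<=` \bigcup_(x in B) F x.

Definition closed_graph {S T : topologicalType} (F : S -> set T) : Prop :=
  closed [set p : S * T | F p.1 p.2].

Definition is_minimum {R : realType} (S : set R) (m : R) : Prop :=
  S m /\ lbound S m.

Definition prod_set {I : Type} {T : I -> Type} (A : forall i, set (T i)) :
    set (prod_topology T) :=
  [set x | forall i, A i (x i)].

(* X_{-i}, with its product topology *)
Notation others X i := (prod_topology (fun j : {j | j != i} => X (val j))).

(* x_{-i} *)
Definition omit {I : eqType} {T : I -> Type} (i : I) (x : prod_topology T) :
    others T i :=
  fun j => x (val j).
Arguments omit {I T} i x.

(* (x_i, x_{-i}), each component being put back in its own place *)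
Definition insert {I : eqType} {T : I -> Type} (i : I) (a : T i)
    (y : others T i) : prod_topology T :=
  fun j => match eq_comparable j i with
           | left ji => ecast k (T k) (esym ji) a
           | right ji => y (exist _ j (introN eqP ji))
           end.

Section insert_theory.
Context {I : eqType} {T : I -> Type} (i : I).

Lemma insert_in (a : T i) (y : others T i) : insert a y i = a.
Proof.
rewrite /insert; case: (eq_comparable i i) => // ii.
by rewrite (eq_irrelevance (esym ii) erefl).
Qed.

Lemma insert_out (a : T i) (y : others T i) j : insert a y (val j) = y j.
Proof.
case: j => j ji; rewrite /insert /=; case: (eq_comparable j i) => [jie|ji'].
  by case/eqP: (ji).
by rewrite (bool_irrelevance ji (introN eqP ji')).
Qed.

Lemma omit_insert (a : T i) (y : others T i) : omit i (insert a y) = y.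
Proof. by apply: functional_extensionality_dep => j; exact: insert_out. Qed.

Lemma insert_omit (x : prod_topology T) : insert (x i) (omit i x) = x.
Proof.
apply: functional_extensionality_dep => j; have [->|ji] := eqVneq j i.
  exact: insert_in.
exact: (insert_out (x i) (omit i x) (exist _ j ji)).
Qed.

End insert_theory.

Section game.
Context {R : realType} {N : nat} {X : 'I_N -> completeNormedModType R}.

Definition bundle_map (C : forall i, others X i -> set (X i)) :
    prod_topology X -> set (prod_topology X) :=
  fun x => prod_set (fun i => C i (omit i x)).

Definition generalized_Nash_equilibrium
    (Xad : forall i, set (X i)) (C : forall i, others X i -> set (X i))
    (J : 'I_N -> prod_topology X -> R) (x : prod_topology X) : Prop :=
  [/\ prod_set Xad x,
      bundle_map C x x &
      forall i, is_minimum
        [set J i (insert a (omit i x)) | a in Xad i `&` C i (omit i x)]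
        (J i x)].

End game.

(* Main.v *)
(* KKM applied to singletons says that every point of X^ad is a fixed point of
   the bundle map, so on X^ad the constraint sets are all of X_i^ad and the game
   is an ordinary convex game.  Its equilibria are the points x with
   f(x, y) >= 0 for all y, where f(x, y) = sum_i J_i(y_i, x_{-i}) - J_i(x) is the
   Nikaido-Isoda function, and Ky Fan's inequality provides one.

   Ky Fan's inequality follows by compactness from the case where y ranges over
   finitely many points y_k and x over their convex hull: colour the points of a
   fine grid of the simplex by an index k minimizing f(x, y_k).  Scarf's lemma
   (a form of Sperner's lemma with linear orders in place of a triangulation)
   finds a small cluster of grid points whose colours exhaust the support of a
   nearby point x.  The average of the f(x, y_k) with the weights of x is at least
   f(x, x) = 0 by convexity, yet all terms in the support are almost minimal. *)
Require Import Defs.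
From mathcomp Require Import all_boot all_order all_algebra.
From mathcomp Require Import all_classical all_reals all_analysis.
From mathcomp Require Import zify ring lra.
Set Implicit Arguments.
Unset Strict Implicit.
Unset Printing Implicit Defensive.
Import Order.TTheory GRing.Theory Num.Theory.
Import numFieldNormedType.Exports.

(** * Scarf's lemma *)

(** [E] restricted to [A] is an involution without fixed points. Induction removes a point with its
    partner; by uniqueness the other points keep their partners. *)
Lemma matching_even (P : finType) (E : rel P) (A : {set P}) :
  symmetric E -> irreflexive E ->
  (forall x, x \in A -> exists2 y, y \in A & E x y) ->
  (forall x y z, x \in A -> y \in A -> z \in A -> E x y -> E x z -> y = z) ->
  ~~ odd #|A|.
Proof.
move=> symE irrE; have [n] := ubnP #|A|; elim: n => // n IHn in A *.
move=> ltA exE unE; have [->|[x Ax]] := set_0Vmem A; first by rewrite cards0.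
have [y Ay Exy] := exE x Ax.
have xy : x != y by apply: contraTneq Exy => ->; rewrite irrE.
have AyX : y \in A :\ x by rewrite !inE eq_sym xy.
have cardA := cardsD1 x A; rewrite (cardsD1 y (A :\ x)) Ax AyX /= in cardA.
rewrite cardA /= negbK; apply: IHn => [|z|z1 z2 z3].
- by rewrite cardA in ltA; lia.
- rewrite !inE => /and3P[zy zx Az]; have [t At Ezt] := exE z Az.
  exists t => //; rewrite !inE At andbT; apply/andP; split.
    apply: contraNneq zx => ty; rewrite ty symE in Ezt.
    by rewrite symE in Exy; apply/eqP; apply: unE Ezt Exy.
  apply: contraNneq zy => tx; rewrite tx symE in Ezt.
  by apply/eqP; apply: unE Ezt Exy.
- by move=> /setD1P[_ /setD1P[_ ?]] /setD1P[_ /setD1P[_ ?]]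
    /setD1P[_ /setD1P[_ ?]]; exact: unE.
Qed.

Section Scarf.
Variables (I U : finType) (w : I -> U -> nat) (c : U -> I) (u0 : U).
Hypothesis w_inj : forall i, injective (w i).

Let T := (U + I)%type.
Let i0 := c u0.

(* [inr k] is a slack point, a vertex at infinity: the least one for the k-th
   order, and above every point of [U] for the others. *)
Let rank (i : I) (z : T) : nat :=
  match z with
  | inl u => (w i u).+1
  | inr k => if k == i then 0 else (\max_u w i u).+2 + enum_rank k
  end.

Let colour (z : T) : I := match z with inl u => c u | inr k => k end.

Let slack (z : T) : bool := if z is inr _ then true else false.

Let rank_inj i : injective (rank i).
Proof.
have wM u : w i u <= \max_u w i u by exact: leq_bigmax.
move=> [u|k] [v|l] /=.
- by move=> [/w_inj ->].
- by case: ifP => // _; have := wM u; lia.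
- by case: ifP => // _; have := wM v; lia.
- case: eqP => [->|_]; case: eqP => [->|_] //= e.
  by congr inr; apply: enum_rank_inj; apply: val_inj; rewrite /=; lia.
Qed.

Let rank_slack i z : rank i (inr i) <= rank i z.
Proof. by rewrite /= eqxx. Qed.

Let rank_lt_slack i k u : k != i -> rank i (inl u) < rank i (inr k).
Proof.
move=> /negbTE /= ->; have : w i u <= \max_u w i u by exact: leq_bigmax.
by lia.
Qed.

Let rank_slack_lt i u : rank i (inr i) < rank i (inl u).
Proof. by rewrite /= eqxx. Qed.

Let rank_neq i z t : z != t -> (rank i z < rank i t) = (rank i z <= rank i t).
Proof. by move=> zt; rewrite ltn_neqAle (inj_eq (@rank_inj i)) zt. Qed.

(** Scarf's primitive sets: each member is indexed by the order in which it is strictly least, and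
    no point of [T] exceeds these minima in all orders at once. *)
Let primitive (f : {ffun I -> T}) :=
  [forall i, forall j, (j != i) ==> (rank i (f i) < rank i (f j))] &&
  [forall z, exists i, rank i z <= rank i (f i)].

Let primitiveP (f : {ffun I -> T}) : reflect
  ((forall i j, j != i -> rank i (f i) < rank i (f j)) /\
   (forall z, exists i, rank i z <= rank i (f i))) (primitive f).
Proof.
apply: (iffP andP) => -[min dom]; split.
- by move=> i j; have /forallP/(_ i)/forallP/(_ j)/implyP := min.
- by move=> z; have /forallP/(_ z)/existsP := dom.
- by apply/forallP => i; apply/forallP => j; apply/implyP; exact: min.
- by apply/forallP => z; apply/existsP.
Qed.

Let primitive_inj (f : {ffun I -> T}) : primitive f -> injective f.
Proof.
case/primitiveP => min _ i j fij; apply/eqP; rewrite eq_sym.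
by apply: contraT => /min; rewrite fij ltnn.
Qed.

Let primitive_le (f : {ffun I -> T}) i j : primitive f -> rank i (f i) <= rank i (f j).
Proof.
case/primitiveP => min _; have [->//|/min] := eqVneq j i; exact: ltnW.
Qed.

(** * Simplices adjacent across a facet *)

Let P := ({ffun I -> T} * I)%type.

(* [(f, i)] encodes the simplex [f] together with its facet opposite to [f i];
   [swap] relates two simplices sharing their distinguished facet. *)
Let swap : rel P := fun p q =>
  [&& p.2 != q.2, q.1 p.2 == p.1 q.2 &
   [forall k, (k != p.2) ==> (k != q.2) ==> (q.1 k == p.1 k)]].

Let swapP (p q : P) : reflect
  [/\ p.2 != q.2, q.1 p.2 = p.1 q.2 &
   forall k, k != p.2 -> k != q.2 -> q.1 k = p.1 k] (swap p q).
Proof.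
apply: (iffP and3P) => -[pq /eqP e r]; split=> //; try exact/eqP.
  by move=> k kp kq; have /forallP/(_ k) := r; rewrite kp kq => /eqP.
by apply/forallP => k; apply/implyP => kp; apply/implyP => kq; apply/eqP/r.
Qed.

Let swap_sym : symmetric swap.
Proof.
by move=> p q; apply/swapP/swapP => -[pq e r]; split;
  rewrite 1?eq_sym // => k kp kq; rewrite r.
Qed.

Let swap_irr : irreflexive swap.
Proof. by move=> p; rewrite /swap eqxx. Qed.

(** The facet's least member for order [i] must take position [i], which decides the position of the
    new vertex; domination then leaves one choice for that vertex. *)
Let swap_unique (p q q' : P) : primitive q.1 -> primitive q'.1 ->
  swap p q -> swap p q' -> q = q'.
Proof.
case: p q q' => f i [g j] [h k] /= Pg Ph /swapP[/= ij gi gE] /swapP[/= ik hi hE].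
have jk : j = k.
  apply/eqP; apply: contraT => jk.
  have := primitive_le i k Pg; have := primitive_le i j Ph.
  have ki : k != i by rewrite eq_sym.
  have ji : j != i by rewrite eq_sym.
  rewrite hi gi hE // gE // 1?eq_sym // => l1 l2.
  have /rank_inj fjk : rank i (f j) = rank i (f k) by apply/eqP; rewrite eqn_leq l1 l2.
  have := primitive_inj Pg; move=> /(_ i k); rewrite gi gE // 1?eq_sym //.
  by move=> /(_ fjk) ik'; rewrite ik' eqxx in ik.
subst k; have gh l : l != j -> g l = h l.
  by move=> lj; have [->|li] := eqVneq l i; rewrite ?gi ?hi ?gE ?hE.
(* A [b j] above [a j] in order [j] would exceed every minimum of [a], the other members being
   shared. *)
have le (a b : {ffun I -> T}) : (forall l, l != j -> a l = b l) ->
    primitive a -> primitive b -> rank j (b j) <= rank j (a j).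
  move=> ab /primitiveP[_ /(_ (b j))[l]] Hl /primitiveP[minb _].
  case: (eqVneq l j) Hl => [->//|lj Hl]; have := minb l j; rewrite eq_sym lj.
  by move=> /(_ isT); rewrite -ab //; lia.
congr pair; apply/ffunP => l; have [->|/gh//] := eqVneq l j.
apply: (@rank_inj j); apply/eqP; rewrite eqn_leq !le // => l' /gh //.
Qed.

(** Pivoting: once [f i] is dropped, the least remaining member in order [i] moves to position [i],
    and its old position [j] receives the point highest in order [j] among those above the other
    minima. *)
Let swap_exists (f : {ffun I -> T}) i l : primitive f -> l != i -> ~~ slack (f l) ->
  exists2 q, primitive q.1 & swap (f, i) q.
Proof.
move=> Pf li; case fl: (f l) => [u|//] _.
have [min dom] := primitiveP _ Pf.
have [j ji jmin] := @arg_minnP _ l (fun k => k != i) (fun k => rank i (f k)) li.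
pose Z z := (rank i (f j) < rank i z) &&
  [forall k, (k != i) ==> (k != j) ==> (rank k (f k) < rank k z)].
(* Outside order [j], [inr j] exceeds all of [U], hence [f l], whose ranks bound the minima
   concerned. *)
have Zs : Z (inr j).
  apply/andP; split.
    by have := jmin _ li; rewrite fl => /leq_ltn_trans; apply; exact: rank_lt_slack.
  apply/forallP => k; apply/implyP => _; apply/implyP => kj.
  by have := primitive_le k l Pf; rewrite fl => /leq_ltn_trans; apply;
    apply: rank_lt_slack; rewrite eq_sym.
have [y /andP[Zy1 /forallP Zy2] ymax] := @arg_maxnP _ _ Z (rank j) Zs.
have {}Zy2 k : k != i -> k != j -> rank k (f k) < rank k y.
  by move=> ki kj; have := Zy2 k; rewrite ki kj.
have ij : i != j by rewrite eq_sym.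
pose g := [ffun k => if k == i then f j else if k == j then y else f k].
have gi : g i = f j by rewrite ffunE eqxx.
have gj : g j = y by rewrite ffunE (negbTE ji) eqxx.
have gE k : k != i -> k != j -> g k = f k.
  by move=> /negbTE ki /negbTE kj; rewrite ffunE ki kj.
(* [f] can dominate [y] only in order [j], so [y] will be least there. *)
have yj : rank j y < rank j (f j).
  have [k yk] := dom y.
  have [ki|ki] := eqVneq k i; first by subst k; have := min i j ji; lia.
  have [kj|kj] := eqVneq k j; last by have := Zy2 k ki kj; lia.
  subst k; rewrite rank_neq //; apply: contraTneq Zy1 => ->; by rewrite ltnn.
exists (g, j); last by apply/swapP; split.
apply/primitiveP; split => /= [a b|z].
  have [->{a}|ai] := eqVneq a i.
    rewrite gi => bi; have [->|bj] := eqVneq b j; first by rewrite gj.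
    rewrite gE // rank_neq ?jmin //.
    by rewrite (inj_eq (primitive_inj Pf)) eq_sym.
  have [->{a ai}|aj] := eqVneq a j => ab.
    rewrite gj; have [->|bi] := eqVneq b i; first by rewrite gi.
    by rewrite gE //; apply: (ltn_trans yj); apply: min.
  rewrite gE //; have [->|bi] := eqVneq b i; first by rewrite gi min // eq_sym.
  have [->|bj] := eqVneq b j; first by rewrite gj; apply: Zy2.
  by rewrite gE //; apply: min.
apply/existsP; apply: contraT => /existsPn Hz.
have {}Hz k : rank k (g k) < rank k z by rewrite ltnNge.
have /ymax : Z z.
  rewrite /Z -gi Hz /=; apply/forallP => k.
  by apply/implyP => ki; apply/implyP => kj; rewrite -gE.
by have := Hz j; rewrite gj; lia.
Qed.

(** * Parity of the almost rainbow facets *)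

Let states : {set P} := [set p |
  [&& primitive p.1,
   [forall k, (k != p.2) ==> (colour (p.1 k) != i0)] &
   [forall k, forall l, (k != p.2) ==> (l != p.2) ==>
      (colour (p.1 k) == colour (p.1 l)) ==> (k == l)]]].

Let statesP (p : P) : reflect
  [/\ primitive p.1, forall k, k != p.2 -> colour (p.1 k) != i0 &
   forall k l, k != p.2 -> l != p.2 -> colour (p.1 k) = colour (p.1 l) -> k = l]
  (p \in states).
Proof.
rewrite inE; apply: (iffP and3P) => -[Pp ci cinj]; split=> //.
- by move=> k; have /forallP/(_ k)/implyP := ci.
- move=> k l kp lp e; have /forallP/(_ k)/forallP/(_ l) := cinj.
  by rewrite kp lp e eqxx => /eqP.
- by apply/forallP => k; apply/implyP; exact: ci.
- apply/forallP => k; apply/forallP => l; apply/implyP => kp.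
  by apply/implyP => lp; apply/implyP => /eqP e; apply/eqP/cinj.
Qed.

(** [colour] injects the facet into the colours other than [i0], a set of the same size, so the
    facet shows each of them exactly once. *)
Let states_onto (f : {ffun I -> T}) i k : (f, i) \in states -> k != i0 ->
  exists2 j, j != i & colour (f j) = k.
Proof.
case/statesP => /= _ ci cinj ki.
have sub : [set colour (f j) | j in [set~ i]] \subset [set~ i0].
  by apply/fintype.subsetP => _ /imsetP[j ji ->]; rewrite !inE in ji *; exact: ci.
have : [set colour (f j) | j in [set~ i]] == [set~ i0].
  rewrite eqEcard sub card_in_imset ?cardsC1 ?leqnn // => j l.
  by rewrite !inE; exact: cinj.
move=> /eqP /setP /(_ k); rewrite !inE ki => /imsetP[j].
by rewrite !inE => ji ->; exists j.
Qed.

Let outside (p : P) := [forall k, (k != p.2) ==> slack (p.1 k)].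

Let swap_states (p q : P) : primitive q.1 -> swap p q -> p \in states -> q \in states.
Proof.
case: p q => f i [g j] /= Pg /swapP[/= ij gi gE] /statesP[/= Pf ci cinj].
have ji : j != i by rewrite eq_sym.
apply/statesP; split=> //= [k kj|k l kj lj].
  by have [->|ki] := eqVneq k i; rewrite ?gi ?gE // ci.
have [->|ki] := eqVneq k i; have [->|li] := eqVneq l i => //.
- by rewrite gi gE // => /cinj -/(_ ji li) jl; rewrite jl eqxx in lj.
- by rewrite gi gE // => /cinj -/(_ ki ji) kj'; rewrite kj' eqxx in kj.
- by rewrite !gE //; exact: cinj.
Qed.

Let swap_outside (p q : P) : swap p q -> outside q -> outside p.
Proof.
case: p q => f i [g j] /swapP[/= ij gi gE] /forallP out.
apply/forallP => k; apply/implyP => /= ki.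
have [->|kj] := eqVneq k j; first by have := out i; rewrite /= ij gi.
by have := out k; rewrite /= kj gE.
Qed.

(** [swap] keeps the facet, hence its colours and whether it is all slack, so it matches these
    states in pairs. *)
Let inside_even : ~~ odd #|[set p in states | ~~ outside p]|.
Proof.
apply: (matching_even swap_sym swap_irr) => [[f i]|p q q'].
  rewrite inE => /andP[Sp /forallPn[l]]; rewrite negb_imply /= => /andP[li fl].
  have [Pf _ _] := statesP _ Sp.
  have [q Pq pq] := swap_exists Pf li fl; exists q => //.
  rewrite inE (swap_states Pq pq Sp) /=; apply/negP => /(swap_outside pq).
  by move=> /forallP/(_ l); rewrite li (negbTE fl).
rewrite !inE => _ /andP[/and3P[Pq _ _] _] /andP[/and3P[Pq' _ _] _].
exact: swap_unique.
Qed.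

(** The facet must consist of all [inr k] with [k != i0], and domination forces the opposite vertex
    to be the highest point of [U] in order [i0]. *)
Let outside_unique : exists p, [set q in states | outside q] = [set p].
Proof.
have [t _ tmax] := @arg_maxnP _ u0 predT (w i0) isT.
pose f := [ffun k => if k == i0 then inl t else inr k : T].
have fi0 : f i0 = inl t by rewrite ffunE eqxx.
have fE k : k != i0 -> f k = inr k by move=> /negbTE ki; rewrite ffunE ki.
exists (f, i0); apply/setP => -[g i]; rewrite finset.in_set finset.in_set1.
apply/andP/eqP; last first.
  move=> -[-> ->{g i}]; split; last first.
    by apply/forallP => k; apply/implyP => /= ki; rewrite fE.
  apply/statesP; split => /= [|k ki|k l ki li].
  - apply/primitiveP; split => [i j|[u|k]].
    + have [->{i}|ii] := eqVneq i i0 => ji.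
        by rewrite fi0 fE // rank_lt_slack.
      rewrite (fE i) //; have [->|ji0] := eqVneq j i0.
        by rewrite fi0 rank_slack_lt.
      by rewrite fE // rank_neq ?rank_slack //; apply: contra_neq ji => -[].
    + by exists i0; rewrite fi0 /= ltnS; exact: tmax.
    + by exists k; have [->|ki] := eqVneq k i0; rewrite ?fi0 ?fE // rank_slack.
  - by rewrite fE.
  - by rewrite !fE.
case=> Sp /forallP /= out; have [/= Pg ci cinj] := statesP _ Sp.
have {}out k : k != i -> g k = inr (colour (g k)).
  by move=> ki; have := out k; rewrite ki; case: (g k).
have slack_in k : k != i0 -> exists2 j, j != i & g j = inr k.
  by move=> /(states_onto Sp)[j ji <-]; exists j => //; exact: out.
(* A slack vertex would either repeat a member of the facet or complete the set of all slack points,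
   which dominates no point of [U]. *)
have [u gi] : exists u, g i = inl u.
  case gi: (g i) => [u|k]; first by exists u.
  have [ki|ki] := eqVneq k i0; last first.
    have [j ji] := slack_in k ki; rewrite -gi => /(primitive_inj Pg) jiE.
    by rewrite jiE eqxx in ji.
  have [l ul] := (primitiveP _ Pg).2 (inl u0).
  have [j gj] : exists j, g j = inr l.
    have [->|/slack_in[j _ gj]] := eqVneq l i0; last by exists j.
    by exists i; rewrite gi ki.
  have := leq_trans ul (primitive_le l j Pg).
  by rewrite gj leqNgt rank_slack_lt.
have gE k : k != i -> g k = inr k.
  move=> ki; have := out k ki; move: (colour _) => l gk; rewrite gk; congr inr.
  apply/eqP; apply: contraT => lk.
  have := primitive_le k i Pg; rewrite gk gi.
  by rewrite leqNgt rank_lt_slack.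
have ii0 : i = i0.
  by apply/eqP; apply: contraT; rewrite eq_sym => /[dup] /gE e /ci; rewrite e eqxx.
subst i; congr pair; apply/ffunP => k.
have [->|/[dup] /fE -> /gE //] := eqVneq k i0; rewrite fi0 gi; congr inl.
apply: (@w_inj i0); apply/eqP; rewrite eqn_leq; apply/andP; split.
  exact: tmax.
have [l tl] := (primitiveP _ Pg).2 (inl t).
have [li|li] := eqVneq l i0; first by subst l; move: tl; rewrite gi.
by move: tl; rewrite (gE l) // leqNgt rank_slack_lt.
Qed.

Let states_odd : odd #|states|.
Proof.
have [p outE] := outside_unique.
rewrite -(cardsID [set q | outside q] states).
have -> : states :&: [set q | outside q] = [set p].
  by rewrite -outE; apply/setP => q; rewrite !inE.
have -> : states :\: [set q | outside q] = [set q in states | ~~ outside q].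
  by apply/setP => q; rewrite !inE andbC.
by rewrite cards1 oddD (negbTE inside_even).
Qed.

(** Without a rainbow primitive set, the vertex opposite the facet repeats exactly one colour of it.
    Passing to the other vertex of that colour matches the states in pairs, against their odd
    number. *)
Let colourful : [exists f, primitive f && injectiveb (colour \o f)].
Proof.
apply: contraT => none; move: states_odd; apply: contraTT => _.
pose E (p q : P) :=
  [&& p.1 == q.1, p.2 != q.2 & colour (p.1 p.2) == colour (q.1 q.2)].
apply: (@matching_even _ E).
- by move=> p q; rewrite /E eq_sym [p.2 == _]eq_sym [colour _ == _]eq_sym.
- by move=> p; rewrite /E eqxx eqxx.
- move=> [f i] Sp; have [/= Pf ci cinj] := statesP _ Sp.
  have [fi|fi] := eqVneq (colour (f i)) i0.
    case/existsP: none; exists f; rewrite Pf; apply/injectiveP => k l /=.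
    have [->|ki] := eqVneq k i; have [->|li] := eqVneq l i => //.
    + by rewrite fi => e; have := ci l li; rewrite -e eqxx.
    + by rewrite fi => e; have := ci k ki; rewrite e eqxx.
    + exact: cinj.
  have [j ji fj] := states_onto Sp fi; exists (f, j); last first.
    by rewrite /E /= eqxx fj eqxx eq_sym ji.
  apply/statesP; split=> //= [k kj|k l kj lj].
    by have [->//|/ci] := eqVneq k i.
  have [->|ki] := eqVneq k i; have [->|li] := eqVneq l i => //.
  + by rewrite -fj => /cinj -/(_ ji li) e; rewrite e eqxx in lj.
  + by rewrite -fj => /cinj -/(_ ki ji) e; rewrite e eqxx in kj.
  + exact: cinj.
- move=> [f i] [g j] [h k] Sp _ _ /and3P[/= /eqP <- ij /eqP fj].
  move=> /and3P[/= /eqP <- ik /eqP fk].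
  have [/= _ _ cinj] := statesP _ Sp.
  by congr pair; apply: cinj; rewrite 1?eq_sym // -fj.
Qed.

(** [C] collects the positions of a rainbow primitive set not held by slack points. A slack point
    can only hold its own position, so the slack colours are those outside [C], and members of [U]
    supply the colours in [C]. *)
Lemma scarf : exists (C : {set I}) (f : I -> U),
  [/\ forall u, exists2 i, i \in C & w i u <= w i (f i),
      forall i j, i \in C -> j \in C -> w i (f i) <= w i (f j) &
      forall k, k \in C -> exists2 j, j \in C & c (f j) = k].
Proof.
have /existsP[g /andP[Pg /injectiveP ginj]] := colourful.
have [_ dom] := primitiveP _ Pg.
have surj i : exists j, colour (g j) = i.
  by have [h _ hK] := injF_bij ginj; exists (h i); exact: hK.
have [l [v gl]] : exists l v, g l = inl v.
  have [/existsP[l]|] := boolP [exists l, ~~ slack (g l)].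
    by case gl: (g l) => [v|//] _; exists l, v.
  move=> /existsPn allS.
  have [i ui] := dom (inl u0); have [j] := surj i.
  have := allS j; case gj: (g j) => [//|k] _ /= ki; subst k.
  have := leq_trans ui (primitive_le i j Pg).
  by rewrite gj leqNgt rank_slack_lt.
have gS i k : g i = inr k -> k = i.
  move=> gi; apply/eqP; apply: contraT => ki.
  by have := primitive_le i l Pg; rewrite gl gi leqNgt rank_lt_slack.
exists [set i | ~~ slack (g i)], (fun i => if g i is inl u then u else u0).
split=> [u|i j|k].
- have [i ui] := dom (inl u); exists i; rewrite ?inE.
    move: ui; case gi: (g i) => [//|k].
    by rewrite (gS _ _ gi) leqNgt rank_slack_lt.
  by move: ui; case gi: (g i) => [//|k]; rewrite (gS _ _ gi) leqNgt rank_slack_lt.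
- rewrite !inE; have := primitive_le i j Pg.
  by case: (g i) (g j) => [u|?] [v'|?].
- rewrite inE; have [j gj] := surj k; move: gj; case gj: (g j) => [u|i] /= e.
    by exists j; rewrite ?inE gj.
  by subst k; have := gS _ _ gj => ij; subst i; rewrite gj.
Qed.
End Scarf.

(** * Colourings of the grid points of a simplex *)

Section Grid.
Variables (I : finType) (i1 : I) (m : nat) (c : {ffun I -> nat} -> I).

Let U := {a : {ffun I -> 'I_m.+1} | \sum_i (a i : nat) == m}.

Let coord (u : U) : {ffun I -> nat} := [ffun i => val u i : nat].

Let coord_sum u : \sum_i coord u i = m.
Proof. by rewrite -[RHS](eqP (valP u)); apply: eq_bigr => i _; rewrite ffunE. Qed.

Let coord_onto (a : I -> nat) : \sum_i a i = m -> exists u, forall i, coord u i = a i.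
Proof.
move=> am; have am' i : a i < m.+1.
  by rewrite ltnS -am (bigD1 i) //= leq_addr.
have Ua : \sum_i ([ffun i => Ordinal (am' i)] i : nat) == m.
  by rewrite -[X in _ == X]am; apply/eqP/eq_bigr => i _; rewrite ffunE.
by exists (Sub [ffun i => Ordinal (am' i)] Ua : U) => i; rewrite !ffunE.
Qed.

(** A lexicographic order: the coordinate decides, and [enum_rank u], smaller than the factor,
    breaks ties. *)
Let w (i : I) (u : U) := coord u i * #|{: U}| + enum_rank u.

Let w_le i u v : w i u <= w i v -> coord u i <= coord v i.
Proof.
rewrite /w => uv; have U0 : 0 < #|{: U}| by apply/card_gt0P; exists u.
rewrite -ltnS -(ltn_pmul2r U0) mulSn addnC.
apply: leq_ltn_trans (leq_addr _ _) _; apply: leq_ltn_trans uv _.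
by rewrite ltn_add2l.
Qed.

Let w_inj i : injective (w i).
Proof.
move=> u v uv; have := eq_leq uv; have := eq_leq (esym uv).
move=> /w_le le1 /w_le le2; apply: enum_rank_inj; apply: val_inj => /=.
by move: uv; rewrite /w (anti_leq (introT andP (conj le1 le2))) => /addnI.
Qed.

(** [b] is made of the coordinatewise minima over Scarf's cluster, zero off [C], with the missing
    mass put on one coordinate of [C]. Domination bounds that mass by [#|I|]. *)
Lemma grid_colouring : exists (C : {set I}) (b : {ffun I -> nat}),
  [/\ \sum_i b i = m, forall i, i \notin C -> b i = 0 &
   forall k, k \in C -> exists q : {ffun I -> nat}, [/\ \sum_i q i = m, c q = k &
     forall i, q i <= b i + #|I| /\ b i <= q i + #|I|]].
Proof.
have [u0 _] : exists u : U, forall i, coord u i = (i == i1) * m.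
  apply: coord_onto; rewrite (bigD1 i1) //= eqxx mul1n big1 ?addn0 // => i.
  by move=> /negbTE ->.
have [C [f [dom min col]]] := scarf (fun u => c (coord u)) u0 w_inj.
have [i0 Ci0 _] := dom u0.
pose a i := if i \in C then coord (f i) i else 0.
have le_a i j : j \in C -> a i <= coord (f j) i.
  by rewrite /a; case: ifP => // Ci Cj; apply/w_le/min.
have am : \sum_i a i <= m.
  by rewrite -(coord_sum (f i0)); apply: leq_sum => i _; apply: le_a.
have dump (d : I -> nat) : \sum_i d i <= m ->
    \sum_i (d i + (i == i0) * (m - \sum_i d i)) = m.
  move=> dm; rewrite big_split /= [X in _ + X](bigD1 i0) //= eqxx mul1n.
  by rewrite [X in _ + (_ + X)]big1 ?addn0 ?subnKC // => i /negbTE ->.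
(* Otherwise some grid point exceeds [a] in every coordinate of [C]. *)
have aI : m <= \sum_i a i + #|I|.
  rewrite leqNgt; apply/negP => lt.
  have d1 : \sum_i (a i + 1) <= m by rewrite big_split /= sum1_card ltnW.
  pose d i := if i \in C then a i + 1 else 0.
  have d2 : \sum_i d i <= m.
    by apply: leq_trans d1; apply: leq_sum => i _; rewrite /d; case: ifP.
  have [u uE] := coord_onto (dump _ d2).
  have [i Ci /w_le] := dom u; rewrite uE /d Ci.
  have -> : coord (f i) i = a i by rewrite /a Ci.
  by lia.
exists C, [ffun i => a i + (i == i0) * (m - \sum_i a i)]; split=> [|i|k].
- by rewrite -[RHS](dump a) //; apply: eq_bigr => i _; rewrite ffunE.
- by move=> Ci; rewrite ffunE /a (negbTE Ci); case: eqP Ci => [->|//]; rewrite Ci0.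
- move=> /col[j Cj <-]; exists (coord (f j)); split=> // i; rewrite ffunE.
  have lei := le_a i j Cj; split; last by case: eqP; lia.
  (* The other coordinates are at least those of [a], so coordinate [i] exceeds [a i] by at most the
     missing mass. *)
  have: \sum_(k | k != i) a k <= \sum_(k | k != i) coord (f j) k.
    by apply: leq_sum => l _; apply: le_a.
  have := coord_sum (f j); rewrite (bigD1 i) //=.
  by move: aI am; rewrite (bigD1 i) //=; lia.
Qed.
End Grid.

Local Open Scope classical_set_scope.
Local Open Scope ring_scope.

(** * Ky Fan's inequality *)

(** Uniform continuity with only the centre confined to [K]. The filter form lets finitely many
    functions share one radius. *)
Lemma compact_uniformly_near (R : realType) (V : pseudoMetricType R) (K : set V)
    (f : V -> R) (e : R) : compact K -> continuous f -> 0 < e ->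
  \forall d \near 0^'+, forall x y, K x -> ball x d y -> `|f x - f y| < e.
Proof.
move=> cK cf e0.
have : \forall d \near 0^'+, K `<=` [set x | forall y, ball x d y -> `|f x - f y| < e].
  apply: (compact_near_coveringP K).1 => // x Kx.
  have /cvgrPdist_lt/(_ (e / 2) (divr_gt0 e0 (ltr0n _ 2))) := cf x.
  move=> /nbhs_ballP[r /= r0 xr].
  have r2 : 0 < r / 2 by rewrite divr_gt0.
  exists (ball x (r / 2), [set d | d <= r / 2]) => /=.
    by split; [exact: nbhsx_ballx|exact: nbhs_right_le].
  move=> [z d] /= [xz dr] y zdy.
  have xrz : `|f x - f z| < e / 2.
    by apply: xr; apply: le_ball xz; rewrite ler_pdivrMr // ler_peMr ?ler1n // ltW.
  have xry : `|f x - f y| < e / 2.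
    by apply: xr; rewrite [r]splitr; apply: ball_triangle xz (le_ball dr zdy).
  by rewrite distrC in xrz; have := ler_distD (f x) (f z) (f y); lra.
by apply: filterS => d H x y Kx; exact: H.
Qed.

(** * Approximate complementarity on the simplex *)

Section Simplex.
Variables (R : realType) (n : nat).

Definition simplex : set 'rV[R]_n :=
  [set x | (forall i, 0 <= x ord0 i) /\ \sum_i x ord0 i = 1].

(** Grid points are coloured by an index maximizing [g]. At the point from [grid_colouring], every
    [g k] in the support is then within [e] of the largest, while their weighted mean is at most
    0. *)
Lemma simplex_complementarity (g : 'I_n -> 'rV[R]_n -> R) (e : R) :
  (0 < n)%N -> (forall k, continuous (g k)) ->
  (forall x, simplex x -> \sum_k x ord0 k * g k x <= 0) -> 0 < e ->
  exists2 x, simplex x & forall k, g k x <= e.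
Proof.
move=> n0 cg gx e0; pose i1 := Ordinal n0.
pose K : set 'rV[R]_n := [set x | forall i, `[(0:R), 1]%classic (x ord0 i)].
have cK : compact K.
  apply: (@rV_compact _ _ (fun=> `[(0:R), 1]%classic)) => i.
  exact: segment_compact.
have SK x : simplex x -> K x.
  move=> [x0 x1] i /=; rewrite in_itv /= x0 -x1 (bigD1 i) //= lerDl.
  exact: sumr_ge0.
have : \forall d \near 0^'+, forall k x y, K x -> ball x d y ->
    `|g k x - g k y| < e / 2.
  by apply: filter_forall => k; apply: compact_uniformly_near => //; exact: divr_gt0.
move=> H; near (0:R)^'+ => d.
have d0 : 0 < d by near: d; exact: nbhs_right_gt.
have gd : forall k x y, K x -> ball x d y -> `|g k x - g k y| < e / 2.
  by near: d; exact: H.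
(* [grid_colouring] is precise up to [n] grid steps; this [m] makes [n] steps shorter than [d]. *)
pose m := (Num.bound (n%:R / d)).+1.
have m0 : 0 < m%:R :> R by rewrite ltr0n.
have nm : n%:R < d * m%:R.
  rewrite mulrC -ltr_pdivrMr //.
  have nd0 : 0 <= n%:R / d by rewrite divr_ge0 // ltW.
  by apply: (lt_trans (archi_boundP nd0)); rewrite ltr_nat.
pose pt (q : {ffun 'I_n -> nat}) : 'rV[R]_n := \row_i ((q i)%:R / m%:R).
have ptS (q : {ffun _}) : (\sum_i q i = m)%N -> simplex (pt q).
  move=> qm; split=> [i|]; first by rewrite mxE divr_ge0.
  under eq_bigr => i _ do rewrite mxE.
  by rewrite -mulr_suml -natr_sum qm divff // gt_eqF.
pose c q := [arg max_(k > i1) g k (pt q)]%O.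
have cP q l : g l (pt q) <= g (c q) (pt q).
  by rewrite /c; case: Order.TotalTheory.arg_maxP => // k _; apply.
have [C [b [bm bC near_b]]] := grid_colouring i1 m c.
have Sb := ptS b bm; exists (pt b) => // l.
have gC k : k \in C -> g l (pt b) - e <= g k (pt b).
  move=> /near_b[q [qm <- bq]].
  have bqd : ball (pt b) d (pt q).
    split=> // i j /=; rewrite /ball /= !ord1 !mxE -mulrBl normrM normfV (gtr0_norm m0).
    rewrite ltr_pdivrMr //; apply: le_lt_trans nm; have [] := bq j.
    rewrite card_ord -!(ler_nat R) !natrD ler_norml => l1 l2.
    by apply/andP; split; lra.
  have := gd l _ _ (SK _ Sb) bqd; have := gd (c q) _ _ (SK _ Sb) bqd.
  by rewrite !ltr_norml => /andP[? ?] /andP[? ?]; have := cP q l; lra.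
rewrite -subr_le0; apply: le_trans (gx _ Sb).
rewrite -[leLHS]mul1r -Sb.2 mulr_suml; apply: ler_sum => k _.
have [kC|kC] := boolP (k \in C); first by rewrite ler_wpM2l ?gC // Sb.1.
by rewrite mxE bC // mul0r !mul0r.
Unshelve. all: by end_near. Qed.
End Simplex.

(** * Finite convex combinations *)

Lemma convex_set_sum (R : numFieldType) (E : lmodType R) (A : set E) n
    (l : 'I_n -> R) (y : 'I_n -> E) : @convex_set R E A ->
  (forall k, 0 <= l k) -> \sum_k l k = 1 -> (forall k, A (y k)) ->
  A (\sum_k l k *: y k).
Proof.
move=> cA; elim: n => [|n IHn] in l y *.
  by rewrite big_ord0 => _ /eqP; rewrite eq_sym oner_eq0.
rewrite !big_ord_recl /= => l0 l1 Ay; set S := \sum_(i < n) _ in l1 *.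
have S0 : 0 <= S by exact: sumr_ge0.
have lS : l ord0 = 1 - S by rewrite -l1 addrK.
(* The tail is rescaled by its total weight [S] to apply induction; if [S] is 0, all its weights
   vanish. *)
have [Sz|Snz] := eqVneq S 0.
  rewrite lS Sz subr0 scale1r big1 ?addr0 // => i _.
  move/eqP: Sz; rewrite psumr_eq0 // => /allP/(_ i (mem_index_enum _))/eqP ->.
  by rewrite scale0r.
have l01 : 0 <= l ord0 <= 1 by rewrite l0 lS gerBl.
pose t : {i01 R} := Itv01 (l0 ord0) (andP l01).2.
pose z := \sum_(i < n) (l (lift ord0 i) / S) *: y (lift ord0 i).
have Az : A z.
  apply: IHn => [k||k]; [by rewrite divr_ge0| |exact: Ay].
  by rewrite -mulr_suml divff.
have Acomb : A (l ord0 *: y ord0 + (1 - l ord0) *: z).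
  by have := cA (y ord0) z t; rewrite !inE => /(_ (Ay _) Az).
move: Acomb; rewrite {2}lS subKr /z scaler_sumr.
rewrite (eq_bigr (fun i => l (lift ord0 i) *: y (lift ord0 i))) // => i _.
by rewrite scalerA mulrCA divff // mulr1.
Qed.

(** Jensen's inequality: the epigraph over [A] is convex and contains the points
    [(y k, f (y k))]. *)
Lemma convex_function_sum (R : realType) (E : lmodType R) (A : set E)
    (f : E -> R) n (l : 'I_n -> R) (y : 'I_n -> E) :
  @convex_set R E A -> @convex_function R E A f ->
  (forall k, 0 <= l k) -> \sum_k l k = 1 -> (forall k, A (y k)) ->
  f (\sum_k l k *: y k) <= \sum_k l k * f (y k).
Proof.
move=> cA cf l0 l1 Ay.
pose epi : set (E * R^o)%type := [set p | A p.1 /\ f p.1 <= p.2].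
have cepi : convex_set epi.
  move=> [x a] [z b] t; rewrite !inE => -[/= Ax fx] [/= Az fz]; split.
    by have := cA x z t; rewrite !inE; apply.
  apply: le_trans (cf t _ _ _ _) _; rewrite ?inE //.
  apply: lerD; apply: ler_wpM2l => //.
  by rewrite subr_ge0 le1.
have := convex_set_sum cepi l0 l1 (y := fun k => (y k, f (y k))).
move=> /(_ (fun k => conj (Ay k) (lexx _)))[_].
by rewrite !raddf_sum.
Qed.

Lemma continuous_sum_scale (R : realType) (L : topologicalLmodType R) n
    (y : 'I_n -> L) :
  continuous (fun l : 'rV[R]_n => \sum_k l ord0 k *: y k).
Proof.
apply: continuous_big => [|k _ l]; first exact: add_continuous.
apply: (@continuous2_cvg _ R^o L L (nbhs l) _ (fun u => u ord0 k)
  (fun=> y k) (fun (a : R^o) (b : L) => a *: b)).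
- exact: (scale_continuous (_, _)).
- exact: coord_continuous.
- exact: (@cvg_cst L (y k) _ (nbhs l)).
Qed.

Lemma Ky_Fan (R : realType) (L : topologicalLmodType R) (K : set L)
    (f : L -> L -> R) :
  K !=set0 -> compact K -> @convex_set R L K ->
  (forall y, continuous (f^~ y)) ->
  (forall x, @convex_function R L K (f x)) ->
  (forall x, K x -> 0 <= f x x) ->
  exists2 x, K x & forall y, K y -> 0 <= f x y.
Proof.
move=> [y0 Ky0] cK convK cf convf fxx.
(* The finite case is solved only approximately, so each condition carries its own tolerance; a
   cluster point meets all tolerances. *)
pose D : set (L * R) := [set p | K p.1 /\ 0 < p.2].
pose F (p : L * R) : set L := [set x | K x /\ - p.2 <= f x p.1].
have finF : finI D F.
  (* The extra entry [(y0, 1)] makes the list nonempty, so that the simplex has positive dimension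
     [size s]. *)
  move=> D' D'D; pose s := (y0, 1) :: finmap.enum_fset D'.
  have sD p : p \in s -> D p.
    by rewrite inE => /predU1P[->|/D'D]; [split|rewrite inE].
  have nthD k : (k < size s)%N -> D (nth (y0, 1) s k).
    by move=> ks; apply/sD/mem_nth.
  pose e := \big[Num.min/1]_(k < size s) (nth (y0, 1) s k).2.
  have e0 : 0 < e by apply: lt_bigmin => // k _; have [] := nthD k (ltn_ord k).
  pose y (k : 'I_(size s)) := (nth (y0, 1) s k).1.
  have Ky k : K (y k) by have [] := nthD k (ltn_ord k).
  pose pt (l : 'rV[R]_(size s)) := \sum_k l ord0 k *: y k.
  have cfpt k : continuous (fun l => f (pt l) (y k)).
    move=> l; apply: (@continuous_comp _ L R pt (f^~ (y k)) l _ (cf _ _)).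
    exact: continuous_sum_scale.
  have [l [l0 l1] fl] : exists2 l, simplex l & forall k, - f (pt l) (y k) <= e.
    apply: (simplex_complementarity (g := fun k l => - f (pt l) (y k))) => //.
    - by move=> k l; exact: cvgN (cfpt k l).
    - move=> l [l0 l1].
      under eq_bigr do rewrite mulrN; rewrite sumrN oppr_le0.
      apply: le_trans (convex_function_sum convK (convf (pt l)) l0 l1 Ky).
      by apply: fxx; apply: convex_set_sum.
  exists (pt l) => p pD'; split; first exact: convex_set_sum.
  have ps : p \in s by rewrite inE; apply/orP; right.
  pose k : 'I_(size s) := Ordinal (etrans (index_mem p s) ps).
  have ek : e <= (nth (y0, 1) s k).2 by exact: (@bigmin_inf _ _ _ _ k).
  have := fl k; rewrite lerNl /y => flk.
  by move: ek flk; rewrite /= nth_index // -lerN2; exact: le_trans.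
have [|x [Kx clx]] := cK _ (finI_filter finF).
  by exists (F (y0, 1)) => [|x []//]; apply: finI_from1; split.
exists x => // y Ky; rewrite -oppr_le0; apply/ler_addgt0Pl => e e0.
rewrite addr0 lerNl.
have cl : closed [set x | - e <= f x y].
  exact: ((continuous_closedP _).1 (cf y) _ (@closed_ge _ (- e))).
apply: cl => B; apply: clx; exists (F (y, e)) => [|z []//].
by apply: finI_from1; split.
Qed.

(** * Nash equilibria *)

Lemma insert_omit_continuous (R : numFieldType) (I : eqType)
    (T : I -> topologicalLmodType R) (i : I)
    (a : T i) :
  continuous (fun x : prod_topology T => insert a (omit i x)).
Proof.
apply: prod_topology_continuous => j; have [->|ji] := eqVneq j i.
  rewrite (_ : (fun _ => _) = cst a); first exact: cst_continuous.
  by apply/funext => x; exact: insert_in.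
rewrite (_ : (fun _ => _) = fun x : prod_topology T => x j).
  exact: proj_continuous.
by apply/funext => x; exact: (insert_out a (omit i x) (exist _ j ji)).
Qed.

Theorem theorem3p6 (R : realType) (N : nat) (hN : (1 < N)%N)
    (X : 'I_N -> completeNormedModType R)
    (Xad : forall i : 'I_N, set (X i))
    (C : forall i : 'I_N, others X i -> set (X i))
    (J : 'I_N -> prod_topology X -> R)
    (Xad_nonempty : forall i, Xad i !=set0)
    (Xad_compact : forall i, compact (Xad i))
    (Xad_convex : forall i, convex_set (Xad i))
    (C_convex : forall i (y : others X i), convex_set (C i y))
    (C_closed_graph : forall i, closed_graph (C i))
    (C_sub_Xad : forall i (y : others X i),
      prod_set (fun j : {j | j != i} => Xad (val j)) y -> C i y `<=` Xad i)
    (J_continuous : forall i, continuous (J i))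
    (J_convex : forall i (y : others X i),
      convex_function [set: X i] (fun a : X i => J i (insert a y)))
    (C_KKM : KKM_map (prod_set Xad) (bundle_map C)) :
  exists x : prod_topology X, generalized_Nash_equilibrium Xad C J x.
Proof.
have bundle_fixed x : prod_set Xad x -> bundle_map C x x.
  move=> Xx; have xX : [set x] `<=` prod_set Xad by move=> _ ->.
  by have [|_ ->] := C_KKM.2 _ (finite_set1 x) xX x; first exact: sub_gen_smallest.
pose f (x y : prod_topology X) :=
  \sum_i (J i (insert (y i) (omit i x)) - J i x).
have [x Xx fx] : exists2 x, prod_set Xad x & forall y, prod_set Xad y -> 0 <= f x y.
  apply: Ky_Fan.
  - exact: C_KKM.1.
  - exact: tychonoff.
  - move=> x y t; rewrite !inE => Xx Xy i.
    by have := Xad_convex i (x i) (y i) t; rewrite !inE; apply.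
  - move=> y; apply: continuous_big => [|i _]; first exact: add_continuous.
    have cJ : continuous (fun x : prod_topology X => J i (insert (y i) (omit i x))).
      move=> x; apply: continuous_comp; last exact: J_continuous.
      exact: insert_omit_continuous.
    by move=> x; exact: cvgB (cJ x) (J_continuous i x).
  - move=> x t y z _ _; rewrite convRE /f !mulr_sumr -big_split /=.
    apply: ler_sum => i _.
    (* The subtracted [J i x] does not depend on [y] and the weights add up to 1, so only convexity
       in player [i]'s own variable is at stake. *)
    have := J_convex i (omit i x) t (y i) (z i).
    rewrite !inE => /(_ Logic.I Logic.I); rewrite convRE /unstable.onem => Jle.
    rewrite -(lerD2r (J i x)) subrK; apply: le_trans Jle _.
    by rewrite le_eqVlt; apply/orP; left; apply/eqP; ring.
  - by move=> x _; rewrite /f big1 // => i _; rewrite insert_omit subrr.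
exists x; split=> //; first exact: bundle_fixed.
move=> i; split => /=.
  exists (x i); last by rewrite insert_omit.
  by split; [exact: Xx|exact: bundle_fixed].
move=> _ [a [Xa _] <-].
(* When player [i] deviates alone, every other summand is zero and [f] reduces to that player's gain
   in cost. *)
have := fx (insert a (omit i x)); rewrite /f (bigD1 i) //= insert_in.
rewrite big1 ?addr0 ?subr_ge0 => [|j ji].
  apply=> j; have [->|ji] := eqVneq j i; first by rewrite insert_in.
  by rewrite (insert_out a (omit i x) (exist _ j ji)); exact: Xx.
rewrite (insert_out a (omit i x) (exist _ j ji)).
by rewrite /omit /= insert_omit subrr.
Qed.
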